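(* There is a deterministic algorithm which, given a finite connected undirected graph $G$ with $N \ge 2$ vertices, outputs an $m$-Unbounded Hamiltonian Cycle of $G$, where $m$ is the minimum $k \ge 0$ such that $G$ has a $k$-Unbounded Hamiltonian Cycle, in worst-case time $O(4^N N^2)$ and using memory $O(2^N N)$.
   Context: All graphs are simple. A path here means a finite walk, i.e. a finite sequence of vertices $(x_1,\dots,x_\ell)$ with consecutive vertices adjacent; vertices and edges may repeat. A vertex is bounded in such a path if it appears exactly once in the sequence and unbounded if it appears more than once. A $k$-Unbounded Hamiltonian Path is a path in which every vertex of the graph appears and exactly $k$ vertices are unbounded. A $k$-Unbounded Hamiltonian Cycle is a $k$-Unbounded Hamiltonian Path whose first and last vertices $x_1$, $x_\ell$ are adjacent. Time and memory are measured in the unit-cost word RAM model in which a subset of the vertex set (an $N$-bit mask) fits in a machine word. *)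

(* Defs.v *)
From mathcomp Require Import all_boot.

Set Implicit Arguments.
Unset Strict Implicit.
Unset Printing Implicit Defensive.

Section Walks.
Variables (T : finType) (e : rel T).
Implicit Types (s : seq T) (v : T) (k : nat).

Definition simple_graph := symmetric e /\ irreflexive e.

Definition connected_graph := forall x y : T, connect e x y.

Definition is_walk s : bool := (s != [::]) && sorted e s.

Definition unbounded s v : bool := 1 < count_mem v s.

Definition is_UHP k s : bool :=
  [&& is_walk s, [forall v, v \in s] & #|[set v | unbounded s v]| == k].

Definition is_UHC k s : bool :=
  if s is x :: p then is_UHP k s && e x (last x p) else false.

Definition is_min_UHC_index m : Prop :=
  (exists s, is_UHC m s) /\ (forall k, (exists s, is_UHC k s) -> m <= k).

End Walks.

(* Unit-cost word RAM. A machine has words of [w] bits (naturals below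
   [2 ^ w]), registers that hold one word each, and a random-access memory of
   [M] words. A program is a finite list of instructions, so it mentions
   finitely many registers. Every instruction costs one step. *)

Inductive binop :=
  Add | Sub | Mul | Div | Mod | And | Or | Xor | Shl | Shr | Ltn | Eqn.

Inductive instr :=
  | Const of nat & nat
  | Move  of nat & nat
  | Op    of binop & nat & nat & nat
  | Read  of nat & nat
  | Write of nat & nat
  | Jump  of nat
  | Jumpz of nat & nat
  | Halt.

Definition program := seq instr.

Record config := Config { pc : nat; regs : nat -> nat; mem : nat -> nat }.

Section Machine.
Variables (w M : nat) (P : program).

(* The operations without [%%] map words to words. *)
Definition eval_binop (o : binop) (x y : nat) : nat :=
  match o with
  | Add => (x + y) %% 2 ^ w
  | Sub => (x + 2 ^ w - y) %% 2 ^ w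
  | Mul => (x * y) %% 2 ^ w
  | Div => x %/ y
  | Mod => x %% y
  | And => Nat.land x y
  | Or  => Nat.lor x y
  | Xor => Nat.lxor x y
  | Shl => (x * 2 ^ y) %% 2 ^ w
  | Shr => x %/ 2 ^ y
  | Ltn => x < y
  | Eqn => x == y
  end.

Definition fetch (c : config) : option instr := onth P (pc c).

Definition set_reg (c : config) (d x : nat) : config :=
  Config (pc c).+1 [eta regs c with d |-> x] (mem c).

(* [None] when the machine has halted, when it accesses an address outside its
   [M] words of memory, or when the program counter is out of range. *)
Definition step (c : config) : option config :=
  let r := regs c in
  match fetch c with
  | Some (Const d x) => Some (set_reg c d (x %% 2 ^ w))
  | Some (Move d a) => Some (set_reg c d (r a))
  | Some (Op o d a b) => Some (set_reg c d (eval_binop o (r a) (r b)))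
  | Some (Read d a) =>
      if r a < M then Some (set_reg c d (mem c (r a))) else None
  | Some (Write a b) =>
      if r a < M then Some (Config (pc c).+1 r [eta mem c with r a |-> r b])
      else None
  | Some (Jump l) => Some (Config l r (mem c))
  | Some (Jumpz a l) =>
      Some (Config (if r a == 0 then l else (pc c).+1) r (mem c))
  | Some Halt | None => None
  end.

Fixpoint run (t : nat) (c : config) : option config :=
  if t is t'.+1 then obind (run t') (step c) else Some c.

(* The input occupies the memory from address 0 on; all the other cells and
   all the registers start at 0. *)
Definition init_config (input : seq nat) : config :=
  Config 0 (fun=> 0) (nth 0 input).

Definition halted (c : config) : Prop := fetch c = Some Halt.

(* On halting, [r_0] is the address and [r_1] the length of the output; the
   output lies inside the [M] words of memory. *)
Definition has_output (c : config) (output : seq nat) : Prop :=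
  regs c 0 + regs c 1 <= M /\
  output = [seq mem c (regs c 0 + i) | i <- iota 0 (regs c 1)].

(* On [input], which fits in the [M] words of memory, the machine halts with
   [output] after at most [tmax] steps, all inside these [M] words. *)
Definition computes_within (tmax : nat) (input output : seq nat) : Prop :=
  size input <= M /\
  exists t c, [/\ t <= tmax, run t (init_config input) = Some c,
                  halted c & has_output c output].

End Machine.

(* The number of vertices, then the adjacency matrix in row-major order, one
   word per entry. *)
Definition encode_graph (N : nat) (e : rel 'I_N) : seq nat :=
  N :: [seq nat_of_bool (e i j) | i <- enum 'I_N, j <- enum 'I_N].

(* Main.v *)
Require Import Defs.
From mathcomp Require Import all_boot.
From mathcomp Require Import zify.

Set Implicit Arguments.
Unset Strict Implicit.
Unset Printing Implicit Defensive.

(** For a set [U] of vertices that may be repeated, a closed covering walk in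
which every vertex outside [U] occurs once can be rotated to end at the vertex
0.  Prepending vertices one by one, such walks are explored as paths in the
graph of the [2 ^ N * N] states (set of visited vertices, current vertex),
each with at most [N] successors, so that a breadth-first search decides in
time [O(2^N N^2)] whether the full set can be reached at a neighbour of 0.  The
search is run for each of the [2 ^ N] sets [U], and once more for the smallest
[U] that succeeds; the parent pointers then spell the walk.  Its unbounded
vertices lie in [U], so they realise the minimum. *)

(** * A while language compiled to the word RAM *)

(** States suffice, although walks may be long, because the right to prepend a vertex depends on the
    earlier walk only through the set of visited vertices. The minimum over [U] is the right one
    because the unbounded set of any closed covering walk is itself a set that succeeds. A state
    enters the queue at most once, so a parent chain has fewer than [2 ^ N * N] links; this bounds
    the output as well as the search. Keeping one table per set [U] would exceed the memory bound,
    so a single table is cleared and reused, which is why the winning search has to be repeated.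
    Since words are finite, each arithmetic operation carries an obligation excluding overflow; once
    it is discharged, all reasoning takes place on natural numbers. Time is bounded syntactically,
    each loop invariant having to justify the declared number of iterations. *)

Inductive expr :=
  | Var of nat
  | Lit of nat
  | Bin of binop & expr & expr
  | Rd of expr.

Inductive cmd :=
  | Assign of nat & expr
  | Store of expr & expr
  | Seq of cmd & cmd
  | If of expr & cmd & cmd
  | Skip
  (* The function bounds the number of iterations in terms of the number of
     vertices; it is not compiled and only enters [ctime]. *)
  | While of (nat -> nat) & expr & cmd.

(* Variable [x] lives in register [2 x]; the odd registers are a stack of
   temporaries, of which [ecode t] uses those from [2 t + 1] upwards. *)
Fixpoint ecode (t : nat) (e : expr) : program :=
  match e with
  | Var x => [:: Move t.*2.+1 x.*2]
  | Lit n => [:: Const t.*2.+1 n]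
  | Bin o a b =>
      ecode t a ++ ecode t.+1 b ++ [:: Op o t.*2.+1 t.*2.+1 t.+1.*2.+1]
  | Rd a => ecode t a ++ [:: Read t.*2.+1 t.*2.+1]
  end.

Fixpoint esize (e : expr) : nat :=
  match e with
  | Var _ | Lit _ => 1
  | Bin _ a b => esize a + esize b + 1
  | Rd a => esize a + 1
  end.

Fixpoint csize (c : cmd) : nat :=
  match c with
  | Assign _ e => esize e + 1
  | Store a e => esize a + esize e + 1
  | Seq c1 c2 => csize c1 + csize c2
  | If b c1 c2 => esize b + 1 + csize c1 + 1 + csize c2
  | Skip => 0
  | While _ b c => esize b + 1 + csize c + 1
  end.

Fixpoint code (off : nat) (c : cmd) : program :=
  match c with
  | Assign x e => ecode 0 e ++ [:: Move x.*2 1]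
  | Store a e => ecode 0 a ++ ecode 1 e ++ [:: Write 1 3]
  | Seq c1 c2 => code off c1 ++ code (off + csize c1) c2
  | If b c1 c2 =>
      let o1 := off + esize b + 1 in
      let o2 := o1 + csize c1 + 1 in
      ecode 0 b ++ [:: Jumpz 1 o2] ++ code o1 c1
        ++ [:: Jump (o2 + csize c2)] ++ code o2 c2
  | Skip => [::]
  | While _ b c =>
      let o1 := off + esize b + 1 in
      ecode 0 b ++ [:: Jumpz 1 (o1 + csize c + 1)] ++ code o1 c ++ [:: Jump off]
  end.

(** An upper bound only: both branches of a conditional are added, and a loop is charged one extra
    round for its failing guard. The cost of a concrete program thus unfolds to a plain arithmetic
    expression. *)
Fixpoint ctime (N : nat) (c : cmd) : nat :=
  match c with
  | Seq c1 c2 => ctime N c1 + ctime N c2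
  | If b c1 c2 => esize b + 2 + ctime N c1 + ctime N c2
  | While k b c => (k N).+1 * (esize b + 2 + ctime N c)
  | _ => csize c
  end.

Fixpoint assigned (c : cmd) : seq nat :=
  match c with
  | Assign x _ => [:: x]
  | Seq c1 c2 | If _ c1 c2 => assigned c1 ++ assigned c2
  | While _ _ c => assigned c
  | _ => [::]
  end.

(** * Layout and execution of compiled code *)

Lemma size_ecode t e : size (ecode t e) = esize e.
Proof.
by elim: e t => //= [o a IHa b IHb|a IHa] t; rewrite !size_cat ?IHa ?IHb //= addnA.
Qed.

Lemma size_code off c : size (code off c) = csize c.
Proof.
elim: c off => //= [x e|a e|c1 IH1 c2 IH2|b c1 IH1 c2 IH2|_ b c IH] off.
- by rewrite size_cat size_ecode.
- by rewrite !size_cat !size_ecode /= addnA.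
- by rewrite size_cat IH1 IH2.
- by rewrite !size_cat size_ecode /= size_cat IH1 /= IH2; lia.
- by rewrite !size_cat size_ecode /= size_cat IH /=; lia.
Qed.

Definition code_at (P : program) (off : nat) (C : program) : Prop :=
  forall i, i < size C -> onth P (off + i) = onth C i.

Lemma code_at_cat P off C D :
  code_at P off (C ++ D) ->
  code_at P off C /\ code_at P (off + size C) D.
Proof.
move=> h; split=> i lti.
  by rewrite h ?size_cat ?ltn_addr // onth_cat lti.
by rewrite -addnA h ?size_cat ?ltn_add2l // onth_cat ltnNge leq_addr addKn.
Qed.

Lemma code_at1 P off i : code_at P off [:: i] -> onth P off = Some i.
Proof. by move/(_ 0 isT); rewrite addn0. Qed.

Lemma run_add w M P a b c :
  run w M P (a + b) c = obind (run w M P b) (run w M P a c).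
Proof. by elim: a c => //= a IH c; case: step => //=. Qed.

Lemma run_trans w M P a b c1 c2 c3 :
  run w M P a c1 = Some c2 -> run w M P b c2 = Some c3 ->
  run w M P (a + b) c1 = Some c3.
Proof. by rewrite run_add => -> /=. Qed.

Lemma config_pc p p' r m : p = p' -> Some (Config p r m) = Some (Config p' r m).
Proof. by move->. Qed.

(** * Program logic: exact arithmetic and timed total correctness *)

Definition upd (f : nat -> nat) (a x : nat) : nat -> nat :=
  fun y => if y == a then x else f y.

Section Logic.
Variables (w M N : nat).
Implicit Types (r m : nat -> nat).

(** The condition under which the word operation agrees with the operation on natural numbers, so
    that [eval] contains no modulus. *)
Definition op_safe (o : binop) (x y : nat) : Prop :=
  match o with
  | Add => x + y < 2 ^ w
  | Defs.Sub => y <= x < 2 ^ w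
  | Mul => x * y < 2 ^ w
  | Shl => x * 2 ^ y < 2 ^ w
  | Div | Mod | Ltn | Eqn => True
  | _ => False
  end.

Definition op_val (o : binop) (x y : nat) : nat :=
  match o with
  | Add => x + y
  | Defs.Sub => x - y
  | Mul => x * y
  | Shl => x * 2 ^ y
  | Div => x %/ y
  | Mod => x %% y
  | Ltn => x < y
  | Eqn => x == y
  | _ => 0
  end.

Fixpoint eval r m (e : expr) : nat :=
  match e with
  | Var x => r x
  | Lit n => n
  | Bin o a b => op_val o (eval r m a) (eval r m b)
  | Rd a => m (eval r m a)
  end.

Fixpoint safe r m (e : expr) : Prop :=
  match e with
  | Var _ => True
  | Lit n => n < 2 ^ w
  | Bin o a b =>
      [/\ safe r m a, safe r m b & op_safe o (eval r m a) (eval r m b)]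
  | Rd a => safe r m a /\ eval r m a < M
  end.

Lemma eval_binop_safe o x y : op_safe o x y -> eval_binop w o x y = op_val o x y.
Proof.
case: o => //= h; try by rewrite modn_small.
case/andP: h => yx xw; rewrite -addnBAC // modnDr modn_small //.
exact: leq_ltn_trans (leq_subr _ _) xw.
Qed.

Definition frame c r r' := forall x, x \notin assigned c -> r' x = r x.

(** Total correctness from one initial state, with the time bound and the frame built in. Jump
    targets are absolute, hence the quantification over [off]; the temporaries in odd registers are
    left unconstrained. *)
Definition hoare (c : cmd) r m (Q : (nat -> nat) -> (nat -> nat) -> Prop) :=
  forall P off rg, code_at P off (code off c) -> (forall x, rg x.*2 = r x) ->
  exists n rg' r' m',
    [/\ n <= ctime N c,
        run w M P n (Config off rg m) = Some (Config (off + csize c) rg' m'),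
        forall x, rg' x.*2 = r' x, frame c r r' & Q r' m'].

Lemma run_ecode e t P off rg r m :
  code_at P off (ecode t e) -> (forall x, rg x.*2 = r x) -> safe r m e ->
  exists rg',
    [/\ run w M P (esize e) (Config off rg m) = Some (Config (off + esize e) rg' m),
        rg' t.*2.+1 = eval r m e
      & forall i, (i < t.*2.+1) || ~~ odd i -> rg' i = rg i].
Proof.
elim: e t off rg => [x|x|o a IHa b IHb|a IHa] t off rg /= hP hr.
- move=> _; eexists; split; first by rewrite /step /fetch /= (code_at1 hP) addn1; reflexivity.
    by rewrite /= eqxx hr.
  by move=> i /=; case: eqP => // ->; rewrite ltnn /= odd_double.
- move=> hx; eexists; split; first by rewrite /step /fetch /= (code_at1 hP) addn1; reflexivity.
    by rewrite /= eqxx modn_small.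
  by move=> i /=; case: eqP => // ->; rewrite ltnn /= odd_double.
- case=> sa sb so.
  case/code_at_cat: hP => ha /code_at_cat[hb ho].
  rewrite !size_ecode in hb ho.
  have [rg1 [run1 v1 k1]] := IHa _ _ _ ha hr sa.
  have hr1 x : rg1 x.*2 = r x by rewrite k1 ?odd_double ?orbT.
  have [rg2 [run2 v2 k2]] := IHb _ _ _ hb hr1 sb.
  eexists; split.
  + apply: run_trans (run_trans run1 run2) _.
    by rewrite /= /step /fetch /= (code_at1 ho); apply: config_pc => /=; lia.
  + by rewrite /= eqxx v2 k2 ?v1 ?eval_binop_safe //; apply/orP; left; lia.
  + move=> i hi /=; case: eqP => [ei|_].
      by move: hi; rewrite ei ltnn /= odd_double.
    by rewrite k2 ?k1 //; case/orP: hi => [hi|->]; rewrite ?orbT //; apply/orP; left; lia.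
- case=> sa so; case/code_at_cat: hP => ha ho; rewrite size_ecode in ho.
  have [rg1 [run1 v1 k1]] := IHa _ _ _ ha hr sa.
  eexists; split.
  + apply: run_trans run1 _.
    by rewrite /= /step /fetch /= (code_at1 ho) v1 so; apply: config_pc => /=; lia.
  + by rewrite /= eqxx.
  + move=> i hi /=; case: eqP => [ei|_]; last exact: k1.
    by move: hi; rewrite ei ltnn /= odd_double.
Qed.

Lemma hoare_conseq c r m (Q Q' : (nat -> nat) -> (nat -> nat) -> Prop) :
  hoare c r m Q ->
  (forall r' m', frame c r r' -> Q r' m' -> Q' r' m') -> hoare c r m Q'.
Proof.
move=> h hQ P off rg hP hr; have [n [rg' [r' [m' [a b c' d f]]]]] := h P off rg hP hr.
by exists n, rg', r', m'; split=> //; apply: hQ.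
Qed.

Lemma hoare_skip r m (Q : _ -> _ -> Prop) : Q r m -> hoare Skip r m Q.
Proof. by move=> h P off rg _ hr; exists 0, rg, r, m; split; rewrite //= addn0. Qed.

Lemma hoare_assign x e r m (Q : _ -> _ -> Prop) :
  safe r m e -> Q (upd r x (eval r m e)) m -> hoare (Assign x e) r m Q.
Proof.
move=> se hQ P off rg /code_at_cat[he hx] hr; rewrite size_ecode in hx.
have [rg1 [run1 v1 k1]] := run_ecode he hr se.
exists (esize e + 1); eexists; exists (upd r x (eval r m e)), m; split=> //=.
- apply: run_trans run1 _.
  by rewrite /= /step /fetch /= (code_at1 hx); apply: config_pc => /=; lia.
- move=> y; rewrite /= -[1]/(0.*2.+1) v1 /upd.
  have -> : (y.*2 == x.*2) = (y == x) by lia.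
  by case: eqP => // _; rewrite k1 ?odd_double ?orbT.
- by move=> y; rewrite inE /upd => /negPf->.
Qed.

Lemma hoare_store a e r m (Q : _ -> _ -> Prop) :
  safe r m a -> safe r m e -> eval r m a < M ->
  Q r (upd m (eval r m a) (eval r m e)) -> hoare (Store a e) r m Q.
Proof.
move=> sa se ltM hQ P off rg /code_at_cat[ha /code_at_cat[he hw]] hr.
rewrite !size_ecode in he hw.
have [rg1 [run1 v1 k1]] := run_ecode ha hr sa.
have hr1 x : rg1 x.*2 = r x by rewrite k1 ?odd_double ?orbT.
have [rg2 [run2 v2 k2]] := run_ecode he hr1 se.
have v1' : rg2 1 = eval r m a by rewrite k2.
have v2' : rg2 3 = eval r m e by [].
exists (esize a + esize e + 1), rg2, r; eexists; split=> //=.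
- apply: run_trans (run_trans run1 run2) _.
  by rewrite /= /step /fetch /= (code_at1 hw) v1' v2' ltM; apply: config_pc => /=; lia.
- by move=> x; rewrite k2 ?odd_double ?orbT.
- exact: hQ.
Qed.

Lemma hoare_seq c1 c2 r m (Q : _ -> _ -> Prop) :
  hoare c1 r m (fun r' m' => hoare c2 r' m' Q) -> hoare (Seq c1 c2) r m Q.
Proof.
move=> h P off rg /code_at_cat[h1 h2] hr; rewrite size_code in h2.
have [n1 [rg1 [r1 [m1 [t1 run1 a1 f1 q1]]]]] := h P off rg h1 hr.
have [n2 [rg2 [r2 [m2 [t2 run2 a2 f2 q2]]]]] := q1 P _ _ h2 a1.
exists (n1 + n2), rg2, r2, m2; split=> //=; first by rewrite leq_add.
  by rewrite addnA; apply: run_trans run1 run2.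
by move=> x; rewrite mem_cat negb_or => /andP[x1 x2]; rewrite f2 ?f1.
Qed.

Lemma hoare_if b c1 c2 r m (Q : _ -> _ -> Prop) :
  safe r m b ->
  (eval r m b != 0 -> hoare c1 r m Q) -> (eval r m b = 0 -> hoare c2 r m Q) ->
  hoare (If b c1 c2) r m Q.
Proof.
move=> sb h1 h2 P off rg /code_at_cat[hb /code_at_cat[hz /code_at_cat[hc1 /code_at_cat[hj hc2]]]] hr.
rewrite ?size_code ?size_ecode /= in hz hc1 hj hc2.
have [rg0 [run0 v0 k0]] := run_ecode hb hr sb.
have hr0 x : rg0 x.*2 = r x by rewrite k0 ?odd_double ?orbT.
have [v|v] := eqVneq (eval r m b) 0.
- have [n2 [rg2 [r2 [m2 [t2 run2 a2 f2 q2]]]]] := h2 v P _ _ hc2 hr0.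
  exists (esize b + (1 + n2)), rg2, r2, m2; split=> //=.
  + by rewrite -!addnA leq_add2l; lia.
  + apply: run_trans run0 (run_trans (a := 1) _ (etrans run2 _)); last first.
      by apply: config_pc; lia.
    by rewrite /= /step /fetch /= (code_at1 hz) -[1]/(0.*2.+1) v0 v /=.
  + by move=> x; rewrite mem_cat negb_or => /andP[x1 x2]; rewrite f2.
- have [n2 [rg2 [r2 [m2 [t2 run2 a2 f2 q2]]]]] := h1 v P _ _ hc1 hr0.
  exists (esize b + (1 + (n2 + 1))), rg2, r2, m2; split=> //=.
  + by rewrite -!addnA leq_add2l; lia.
  + apply: run_trans run0 (run_trans (a := 1) _ (run_trans run2 _)).
      by rewrite /= /step /fetch /= (code_at1 hz) -[1]/(0.*2.+1) v0 (negPf v) addn1.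
    by rewrite /= /step /fetch /= (code_at1 hj); try apply: config_pc; lia.
  + by move=> x; rewrite mem_cat negb_or => /andP[x1 x2]; rewrite f2.
Qed.

(** The invariant is indexed by the number of completed iterations, so that the obligation [j < k N]
    under a true guard yields both termination and the time bound. *)
Lemma hoare_while k b c (I : nat -> (nat -> nat) -> (nat -> nat) -> Prop)
    (Q : _ -> _ -> Prop) r m :
  I 0 r m ->
  (forall j r' m', frame c r r' -> I j r' m' ->
     [/\ safe r' m' b, eval r' m' b = 0 -> Q r' m'
       & eval r' m' b != 0 -> j < k N /\ hoare c r' m' (I j.+1)]) ->
  hoare (While k b c) r m Q.
Proof.
move=> I0 hI P off rg hP hr.
(* Induction on the number [d] of iterations still permitted; [d.+1] accounts for the last, failing
   test. *)
have gen d j rg1 r1 m1 : k N - j = d -> frame c r r1 -> I j r1 m1 ->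
    (forall x, rg1 x.*2 = r1 x) ->
    exists n rg' r' m',
      [/\ n <= d.+1 * (esize b + 2 + ctime N c),
          run w M P n (Config off rg1 m1) = Some (Config (off + csize (While k b c)) rg' m'),
          forall x, rg' x.*2 = r' x, frame c r r' & Q r' m']; last first.
  have [n [rg' [r' [m' [t h1 h2 h3 h4]]]]] := gen _ 0 rg r m erefl (fun _ _ => erefl) I0 hr.
  by exists n, rg', r', m'; split=> //=; rewrite subn0 in t.
case/code_at_cat: hP => hb /code_at_cat[hz /code_at_cat[hc hj]].
rewrite ?size_code ?size_ecode /= in hz hc hj.
elim: d j rg1 r1 m1 => [|d IH] j rg1 r1 m1 ed fr Ij hr1.
all: have [sb q0 q1] := hI _ _ _ fr Ij.
all: have [rg0 [run0 v0 k0]] := run_ecode hb hr1 sb.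
all: have hr0 x : rg0 x.*2 = r1 x by rewrite k0 ?odd_double ?orbT.
all: have [v|v] := eqVneq (eval r1 m1 b) 0.
- exists (esize b + 1), rg0, r1, m1; split=> //; [lia | | exact: q0].
  apply: run_trans run0 _.
  by rewrite /= /step /fetch /= (code_at1 hz) -[1]/(0.*2.+1) v0 v /=; apply: config_pc; lia.
- by have [] := q1 v; lia.
- exists (esize b + 1), rg0, r1, m1; split=> //; [lia | | exact: q0].
  apply: run_trans run0 _.
  by rewrite /= /step /fetch /= (code_at1 hz) -[1]/(0.*2.+1) v0 v /=; apply: config_pc; lia.
have [ltj hc'] := q1 v.
have [n2 [rg2 [r2 [m2 [t2 run2 a2 f2 q2]]]]] := hc' P _ _ hc hr0.
have fr2 : frame c r r2 by move=> x hx; rewrite f2 ?fr.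
have [|n3 [rg3 [r3 [m3 [t3 run3 a3 f3 q3]]]]] := IH j.+1 rg2 r2 m2 _ fr2 q2 a2; first lia.
exists (esize b + (1 + (n2 + (1 + n3)))), rg3, r3, m3; split=> //; first lia.
apply: run_trans run0 (run_trans (a := 1) _ (run_trans run2 (run_trans (a := 1) _ run3))).
  by rewrite /= /step /fetch /= (code_at1 hz) -[1]/(0.*2.+1) v0 (negPf v) addn1.
by rewrite /= /step /fetch /= (code_at1 hj); try apply: config_pc; lia.
Qed.

End Logic.

(** * Walks and search states *)

Section Walks.
Variables (T : finType) (e : rel T) (x0 : T).
Implicit Types (U : {set T}) (st : {set T} * T) (p s : seq T).

(* The walk [st.2 :: p], read backwards, leads from [x0] to the state [st]. *)
Definition reach U st p : Prop :=
  [/\ path e st.2 p, last st.2 p = x0, [set x in st.2 :: p] = st.1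
    & forall x, x \notin U -> count_mem x (st.2 :: p) <= 1].

(** No multiplicities are consulted: a visited vertex outside [U] has used up its only occurrence,
    and one in [U] has no limit. *)
Definition allowed U st u : bool := e st.2 u && ((u \notin st.1) || (u \in U)).

Definition extend st u : {set T} * T := (u |: st.1, u).

Definition feasible U : Prop := exists2 v, (exists p, reach U (setT, v) p) & e v x0.

Lemma reach_root U : reach U ([set x0], x0) [::].
Proof.
by split=> //= [|x _]; [apply/setP=> x; rewrite !inE | case: (_ == _)].
Qed.

Lemma reach_extend U st p u :
  symmetric e -> reach U st p -> allowed U st u ->
  reach U (extend st u) (st.2 :: p).
Proof.
move=> esym [hp hl hs hc] /andP[ex hu]; split.
- by rewrite /= esym ex.
- exact: hl.
- by apply/setP=> x; rewrite /= -hs !inE.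
move=> x xU; rewrite [count_mem x _]/= -/(count_mem x (st.2 :: p)).
case: eqP => [ux|_]; last exact: hc.
have {}ux : u = x by [].
by rewrite ux (negPf xU) orbF -hs inE in hu; rewrite (count_memPn hu).
Qed.

(** Completeness of the search, with [D] the final queue. Every suffix of the walk reaches a state
    of [D]: a head outside [U] occurs once, hence not in the suffix, so prepending it is allowed. *)
Lemma reach_closed U (D : {pred {set T} * T}) st p :
  symmetric e -> ([set x0], x0) \in D ->
  (forall st u, st \in D -> allowed U st u -> extend st u \in D) ->
  reach U st p -> st \in D.
Proof.
move=> esym D0 DE; elim: p st => [|y p IH] [S v] [/= hp hl hs hc].
  by rewrite -hs hl; have -> : [set x in [:: x0]] = [set x0] by apply/setP=> x; rewrite !inE.
case/andP: hp => evy hp.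
have hr : reach U ([set x in y :: p], y) p.
  split=> //= x xU; apply: leq_trans (hc x xU); exact: leq_addl.
have -> : (S, v) = extend ([set x in y :: p], y) v.
  by rewrite /extend /= -hs; congr pair; apply/setP=> x; rewrite !inE.
apply: DE; first exact: IH.
rewrite /allowed /= esym evy /=; case: (boolP (v \in U)) => [|vU]; first by rewrite orbT.
rewrite orbF inE; apply/negP=> vp; have := hc v vU; rewrite eqxx.
by move: vp; rewrite -has_pred1 has_count /=; lia.
Qed.

Lemma UHC_feasible k s :
  symmetric e -> is_UHC e k s -> feasible [set v | unbounded s v].
Proof.
move=> esym; case: s => //= y s /andP[/and3P[/andP[_ hw] /forallP hall _]] hc.
have hcyc : cycle e (y :: s) by rewrite /= rcons_path (hw : path e y s) /= esym.
have [i p ep] := rot_to (hall x0).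
(* The closing edge makes the walk a cycle, so it may be cut at [x0]; moving [x0] to the end then
   keeps all multiplicities. *)
have hcyc' : cycle e (x0 :: p) by rewrite -ep rot_cycle.
have perm_yp : perm_eq (rcons p x0) (y :: s) by rewrite perm_rcons -ep perm_rot.
have hin x : x \in rcons p x0 by rewrite (perm_mem perm_yp) hall.
(* A one-vertex walk closes by a loop at [x0], and [x0] itself is then the final state. *)
case: p ep hcyc' perm_yp hin => [|z p] ep hcyc' /permP hperm hin.
  exists x0; last by move: hcyc'; rewrite /= andbT.
  exists [::]; split=> //=.
    by apply/setP=> x; have := hin x; rewrite !inE.
  by move=> x _; case: eqP.
exists z; last by move: hcyc'; rewrite /= esym => /andP[].
exists (rcons p x0); split.
- by move: hcyc' => /= /andP[].
- by rewrite last_rcons.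
- by apply/setP=> x; rewrite in_setT inE; apply: hin.
- by move=> x; rewrite inE /unbounded -leqNgt -hperm.
Qed.

Lemma feasible_UHC U v p :
  reach U (setT, v) p -> e v x0 ->
  is_UHC e #|[set x | unbounded (v :: p) x]| (v :: p)
  /\ [set x | unbounded (v :: p) x] \subset U.
Proof.
case=> /= hp hl hs hc ev; split.
  rewrite hl ev andbT /is_UHP /is_walk /= hp eqxx andbT.
  by apply/forallP=> x; have := in_setT x; rewrite -hs inE.
by apply/subsetP=> x; rewrite inE /unbounded; apply: contraTT => /hc; rewrite -leqNgt.
Qed.

(** Guarantees that the search over all sets succeeds at least once: with unlimited repetition, any
    covering walk from a neighbour of [x0] to [x0] will do. *)
Lemma feasible_setT :
  1 < #|T| -> simple_graph e -> connected_graph e -> feasible setT.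
Proof.
move=> T1 [esym eirr] econ.
have [z ez] : exists z, e z x0.
  have [y yx] : exists y, y != x0.
    apply/existsP; rewrite -negb_forall; apply: contraL T1 => /forallP h.
    rewrite -leqNgt -(card1 x0); apply: subset_leq_card; apply/subsetP=> x _.
    by rewrite inE; apply: h.
  have /connectP[[|z p] /= hp hl] := econ x0 y; first by rewrite hl eqxx in yx.
  by exists z; rewrite esym; case/andP: hp.
(* Connecting paths are concatenated: from [y] to the head of [l], then recursively through its
   tail, and finally to [x0]. *)
have gen (l : seq T) y : exists p, [/\ path e y p, last y p = x0 & {subset l <= y :: p}].
  elim: l y => [|x l IH] y.
    by have /connectP[p hp hl] := econ y x0; exists p.
  have [p [hp hl hs]] := IH x.
  have /connectP[q hq hx] := econ y x.
  exists (q ++ p); split.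
  - by rewrite cat_path hq -hx.
  - by rewrite last_cat -hx.
  move=> t; rewrite inE -cat_cons mem_cat => /orP[/eqP->|/hs].
    by rewrite hx mem_last.
  by rewrite inE => /orP[/eqP->|->]; rewrite ?orbT // hx mem_last.
have [p [hp hl hs]] := gen (enum T) z.
exists z => //; exists p; split=> //= [|x].
  by apply/setP=> x; rewrite !inE; have := hs x (mem_enum _ _); rewrite inE.
by rewrite inE.
Qed.

(** The bounds close up: [m <= #|U|] as the unbounded vertices lie in [U], and [#|U| <= k] as the
    unbounded set of a competing cycle is feasible. *)
Lemma best_UHC U v p :
  symmetric e -> reach U (setT, v) p -> e v x0 ->
  (forall V, feasible V -> #|U| <= #|V|) ->
  let m := #|[set x | unbounded (v :: p) x]| in
  is_min_UHC_index e m /\ is_UHC e m (v :: p).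
Proof.
move=> esym hr ev hU m; have [hu hs] := feasible_UHC hr ev.
split=> //; split; first by exists (v :: p).
move=> k [s hk]; apply: leq_trans (subset_leq_card hs) (leq_trans (hU _ (UHC_feasible esym hk)) _).
by case: s hk => //= y s /andP[/and3P[_ _ /eqP->]].
Qed.

End Walks.

(** * Bit masks and the numbering of states *)

Definition bit (a i : nat) : nat := (a %/ 2 ^ i) %% 2.

Section Masks.
Variable N : nat.
Implicit Types (A : {set 'I_N}) (i : 'I_N).

Lemma sum_bits_lt (b : nat -> bool) n : \sum_(0 <= i < n) b i * 2 ^ i < 2 ^ n.
Proof.
elim: n => [|n IH]; first by rewrite big_geq.
by rewrite big_nat_recr //= expnS; case: (b n); lia.
Qed.

Lemma bit_sum_bits (b : nat -> bool) n j :
  j < n -> bit (\sum_(0 <= i < n) b i * 2 ^ i) j = b j.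
Proof.
elim: n => // n IH; rewrite ltnS leq_eqVlt big_nat_recr //= /bit => /orP[/eqP->|ltjn].
  by rewrite addnC divnMDl ?expn_gt0 // divn_small ?sum_bits_lt // addn0; case: (b n).
(* Divided by [2 ^ j], the top power is even and so disappears modulo 2. *)
have -> : 2 ^ n = 2 ^ (n - j.+1) * 2 * 2 ^ j by rewrite -expnSr -expnD; congr (2 ^ _); lia.
by rewrite mulnA addnC divnMDl ?expn_gt0 // mulnA modnMDl; apply: IH.
Qed.

Definition bitmask A : nat := \sum_(i in A) 2 ^ i.

Definition indicator A (a : nat) : bool :=
  if insub a is Some i then i \in A else false.

Lemma bitmaskE A :
  bitmask A = \sum_(0 <= i < N) indicator A i * 2 ^ i.
Proof.
rewrite big_mkord /bitmask big_mkcond; apply: eq_bigr => i _.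
by rewrite /indicator valK; case: (i \in A); rewrite ?mul1n.
Qed.

Lemma bitmask_lt A : bitmask A < 2 ^ N.
Proof. by rewrite bitmaskE; apply: sum_bits_lt. Qed.

Lemma bit_bitmask A i : bit (bitmask A) i = (i \in A).
Proof.
by rewrite bitmaskE bit_sum_bits // /indicator valK.
Qed.

Lemma bitmask_inj : injective bitmask.
Proof.
move=> A B eAB; apply/setP=> i; have := bit_bitmask A i; rewrite eAB bit_bitmask.
by case: (i \in A); case: (i \in B).
Qed.

(** An injection between finite types of equal cardinality is bijective. This turns each counter
    value of the outer loop into a vertex set. *)
Lemma bitmask_surj a : a < 2 ^ N -> exists A, bitmask A = a.
Proof.
move=> lta; pose f A := Ordinal (bitmask_lt A).
have finj : injective f by move=> A B [] /bitmask_inj.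
have /(inj_card_bij finj)[g _ gK] : #|'I_(2 ^ N)| <= #|{set 'I_N}|.
  by rewrite card_ord -cardsT -powersetT card_powerset cardsT card_ord.
by exists (g (Ordinal lta)); have /(congr1 val) := gK (Ordinal lta).
Qed.

Lemma bitmask1 i : bitmask [set i] = 2 ^ i.
Proof. by rewrite /bitmask big_set1. Qed.

Lemma bitmaskU1 A i : bitmask (i |: A) = bitmask A + (i \notin A) * 2 ^ i.
Proof.
case: (boolP (i \in A)) => [iA|iA]; last by rewrite /bitmask big_setU1 // addnC mul1n.
by rewrite addn0; congr bitmask; apply/setP=> x; rewrite !inE; case: eqP => [->|].
Qed.

Lemma bitmaskT : bitmask setT = 2 ^ N - 1.
Proof.
have -> : bitmask setT = \sum_(i < N) 2 ^ i by apply: eq_bigl => i; rewrite inE.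
elim: N => [|n IH]; first by rewrite big_ord0.
by rewrite big_ord_recr /= IH expnS; have := expn_gt0 2 n; lia.
Qed.

Lemma sum_bit_bitmask A : \sum_(0 <= i < N) bit (bitmask A) i = #|A|.
Proof.
rewrite big_mkord -sum1_card [RHS]big_mkcond; apply: eq_bigr => i _.
by rewrite bit_bitmask; case: (i \in A).
Qed.

Definition state_index (st : {set 'I_N} * 'I_N) : nat := bitmask st.1 * N + st.2.

Lemma state_index_lt st : state_index st < 2 ^ N * N.
Proof. by have := bitmask_lt st.1; have := ltn_ord st.2; rewrite /state_index; nia. Qed.

Lemma state_index_div st : state_index st %/ N = bitmask st.1.
Proof. by have lt2 := ltn_ord st.2; rewrite /state_index divnMDl ?divn_small ?addn0 //; lia. Qed.

Lemma state_index_mod st : state_index st %% N = st.2.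
Proof. by rewrite /state_index modnMDl modn_small. Qed.

Lemma state_index_inj : injective state_index.
Proof.
move=> [A i] [B j] eij; congr pair.
  by apply: bitmask_inj; rewrite -(state_index_div (A, i)) eij state_index_div.
by apply: val_inj; rewrite -[val i](state_index_mod (A, i)) eij state_index_mod.
Qed.

End Masks.

(** * The program *)

(* [xQB] is variable 0 because register 0 must hold the output address. *)
Notation xQB := 0 (only parsing).
Notation xPB := 1 (only parsing).
Notation xN := 2 (only parsing).
Notation xA := 3 (only parsing).
Notation xZ := 4 (only parsing).
Notation xU := 5 (only parsing).
Notation xI := 6 (only parsing).
Notation xCnt := 7 (only parsing).
Notation xHead := 8 (only parsing).
Notation xTail := 9 (only parsing).
Notation xQ := 10 (only parsing).
Notation xS := 11 (only parsing).
Notation xV := 12 (only parsing).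
Notation xB := 13 (only parsing).
Notation xT := 14 (only parsing).
Notation xOk := 15 (only parsing).
Notation xG := 16 (only parsing).
Notation xBest := 17 (only parsing).
Notation xBU := 18 (only parsing).
Notation xLen := 19 (only parsing).

Declare Scope expr_scope.
Delimit Scope expr_scope with X.
Notation "a + b" := (Bin Add a%X b%X) : expr_scope.
Notation "a - b" := (Bin Defs.Sub a%X b%X) : expr_scope.
Notation "a * b" := (Bin Mul a%X b%X) : expr_scope.
Notation "a / b" := (Bin Div a%X b%X) : expr_scope.
Notation "a %% b" := (Bin Mod a%X b%X) : expr_scope.
Notation "a <<< b" := (Bin Shl a%X b%X) (at level 30) : expr_scope.
Notation "a < b" := (Bin Ltn a%X b%X) : expr_scope.
Notation "a == b" := (Bin Eqn a%X b%X) : expr_scope.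
Notation "$ x" := (Var x) (at level 5, x at level 0, format "$ x") : expr_scope.
Notation "# n" := (Lit n) (at level 5, n at level 0, format "# n") : expr_scope.
Notation "@[ a ]" := (Rd a%X) (at level 5, format "@[ a ]") : expr_scope.

Declare Scope cmd_scope.
Delimit Scope cmd_scope with C.
Notation "x ::= a" := (Assign x a%X) (at level 60) : cmd_scope.
Notation "a <== b" := (Store a%X b%X) (at level 60) : cmd_scope.
Notation "c1 ;; c2" := (Seq c1%C c2%C) (at level 80, right associativity) : cmd_scope.
Notation "'while' b 'upto' k 'do' c 'od'" := (While k b%X c%C)
  (at level 0, k at level 0, b at level 60, c at level 80) : cmd_scope.
Notation "'when' b 'then' c 'end'" := (If b%X c%C Skip)
  (at level 0, b at level 60, c at level 80) : cmd_scope.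

Notation incr x := (Assign x ($x + #1)%X).
Notation bitx x i := (($x / (#1 <<< $i)) %% #2)%X.

Definition popcount : cmd := (
  xCnt ::= #0;; xI ::= #0;;
  while $xI < $xN upto id do
    xCnt ::= $xCnt + bitx xU xI;; incr xI
  od)%C.

Definition clear : cmd := (
  xI ::= #0;;
  while $xI < $xZ upto (fun n => 2 ^ n * n) do
    $xPB + $xI <== #0;; incr xI
  od)%C.

(* Tries to extend the state at queue position [xHead - 1] by the vertex [xI]. *)
Definition visit : cmd := (
  xB ::= bitx xS xI;;
  xOk ::= @[#1 + $xV * $xN + $xI] * (#0 < ($xB == #0) + bitx xU xI);;
  xT ::= ($xS + ($xB == #0) * (#1 <<< $xI)) * $xN + $xI;;
  when $xOk * (@[$xPB + $xT] == #0) then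
    $xPB + $xT <== $xQ + #1;;
    $xQB + $xTail <== $xT;;
    incr xTail
  end;;
  incr xI)%C.

(* The root ({0}, 0) has number [N]; table entries are parents plus one, and
   0 marks a state that has not been reached. *)
Definition search : cmd := (
  clear;;
  $xPB + $xN <== #1;;
  $xQB <== $xN;;
  xHead ::= #0;; xTail ::= #1;;
  while $xHead < $xTail upto (fun n => 2 ^ n * n) do
    xQ ::= @[$xQB + $xHead];;
    incr xHead;;
    xS ::= $xQ / $xN;; xV ::= $xQ %% $xN;;
    xI ::= #0;;
    while $xI < $xN upto id do visit od
  od)%C.

(** [$xA - #1] is the mask of the full set. Its states have nonzero numbers, so [xG = 0] can signal
    failure. *)
Definition check : cmd := (
  xG ::= #0;; xI ::= #0;;
  while $xI < $xN upto id do
    xT ::= ($xA - #1) * $xN + $xI;;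
    when @[#1 + $xI * $xN] * (#0 < @[$xPB + $xT]) then xG ::= $xT end;;
    incr xI
  od)%C.

(** Memory layout: the input in cells 0 to [N * N], then the parent table and the queue, with
    [2 ^ N * N] cells each. *)
Definition setup : cmd := (
  xN ::= @[#0];; xA ::= #1 <<< $xN;; xZ ::= $xA * $xN;;
  xPB ::= $xN * $xN + #1;; xQB ::= $xPB + $xZ)%C.

(** The initial value [N + 1] exceeds every cardinality, so the first set that succeeds is always
    recorded. *)
Definition find_best : cmd := (
  xBest ::= $xN + #1;; xU ::= #0;;
  while $xU < $xA upto (fun n => 2 ^ n) do
    popcount;; search;; check;;
    when (#0 < $xG) * ($xCnt < $xBest) then
      xBest ::= $xCnt;; xBU ::= $xU
    end;;
    incr xU
  od)%C.

(* The parent table is still needed, so the output overwrites the queue. *)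
Definition extract : cmd := (
  xQ ::= $xG;;
  $xQB <== $xQ %% $xN;;
  xLen ::= #1;;
  while ($xQ == $xN) == #0 upto (fun n => 2 ^ n * n) do
    xQ ::= @[$xPB + $xQ] - #1;;
    $xQB + $xLen <== $xQ %% $xN;;
    incr xLen
  od)%C.

Definition main : cmd :=
  (setup;; find_best;; xU ::= $xBU;; search;; check;; extract)%C.

(** * Correctness of the program *)

Section Correctness.
Variables (N : nat) (e : rel 'I_N) (w : nat).
Hypotheses (N_gt1 : 1 < N) (e_simple : simple_graph e).

Let Z := 2 ^ N * N.
(** The data occupy [N * N + 1 + 2 * Z <= 3 * Z] cells; the factor 8 leaves room for the overflow
    obligations. *)
Let M := 8 * Z.
Hypothesis M_le : M <= 2 ^ w.
Let PB := N * N + 1.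
Let QB := PB + Z.
Let x0 : 'I_N := Ordinal (ltnW N_gt1).
Let state := ({set 'I_N} * 'I_N)%type.
Let root : state := ([set x0], x0).
Implicit Types (r m : nat -> nat) (U : {set 'I_N}) (st : state) (p : seq 'I_N).

Definition env r : Prop :=
  [/\ r xN = N, r xA = 2 ^ N, r xZ = Z, r xPB = PB & r xQB = QB].

Definition graph_in m : Prop := forall i j : 'I_N, m (1 + i * N + j) = e i j.

Lemma sizes :
  [/\ [/\ 2 ^ N <= Z, N < Z, N * N < Z & 4 <= 2 ^ N], N < 2 ^ N, M = 8 * Z,
      8 * Z <= 2 ^ w & QB = PB + Z /\ PB = N * N + 1].
Proof.
have h : N < 2 ^ N by exact: ltn_expl.
have h4 : 2 ^ 2 <= 2 ^ N by rewrite leq_exp2l.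
by rewrite /Z; split=> //; split=> //; nia.
Qed.

Lemma state_index_root : state_index root = N.
Proof. by rewrite /state_index bitmask1 /= mul1n addn0. Qed.

Lemma env_frame c r r' :
  all (fun x => x \notin assigned c) [:: xN; xA; xZ; xPB; xQB] ->
  frame c r r' -> env r -> env r'.
Proof. by case/and5P=> h1 h2 h3 h4 /andP[h5 _] f [*]; split; rewrite f. Qed.

Lemma index_lt_Z st : state_index st < Z.
Proof. exact: state_index_lt. Qed.

Lemma pow_lt i : i < N -> 2 ^ i < 2 ^ N.
Proof. by move=> h; rewrite ltn_exp2l. Qed.

Lemma bit_le1 a i : bit a i <= 1.
Proof. by rewrite -ltnS ltn_mod. Qed.

Ltac arith := rewrite /= /upd /=; repeat split; lia.

Lemma popcount_spec U r m :
  env r -> r xU = bitmask U ->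
  hoare w M N popcount r m (fun r' m' => m' = m /\ r' xCnt = #|U|).
Proof.
move=> [rN _ _ _ _] rU; have [[Z1 Z2 Z3 Z4] Z5 Z6 Z7 _] := sizes.
apply: hoare_seq; apply: hoare_assign; first arith.
apply: hoare_seq; apply: hoare_assign; first arith.
apply: (hoare_while (I := fun j r' m' => [/\ m' = m, r' xI = j, j <= N &
  r' xCnt = \sum_(0 <= i < j) bit (bitmask U) i])).
  by split=> //; rewrite /upd /= big_geq.
move=> j r' m' fr [-> rI jN rC].
have r'N : r' xN = N by rewrite fr.
have r'U : r' xU = bitmask U by rewrite fr.
rewrite /= r'N rI; split=> [|/eqP|].
- by [].
- rewrite eqb0 -leqNgt => Nj; split=> //; rewrite rC.
  have -> : j = N by lia.
  exact: sum_bit_bitmask.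
rewrite eqb0 negbK => ltjN; split=> //.
have cle : r' xCnt <= N.
  rewrite rC; apply: leq_trans (_ : \sum_(0 <= i < j) 1 <= _); last by rewrite sum_nat_const_nat; lia.
  by apply: leq_sum => i _; exact: bit_le1.
have p2 := pow_lt ltjN; have b1 := bit_le1 (bitmask U) j; rewrite /bit in b1.
apply: hoare_seq; apply: hoare_assign.
  by rewrite /= rI r'U; repeat split; lia.
apply: hoare_assign; first arith.
split=> //; rewrite /upd /= ?rI ?addn1 // big_nat_recr //= rC /bit.
by rewrite mul1n r'U.
Qed.

Lemma clear_spec r m :
  env r -> graph_in m ->
  hoare w M N clear r m (fun r' m' =>
    graph_in m' /\ forall a, a < Z -> m' (PB + a) = 0).
Proof.
move=> [rN _ rZ rPB _] gm; have [[Z1 Z2 Z3 Z4] Z5 Z6 Z7 [Z8 Z9]] := sizes.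
apply: hoare_seq; apply: hoare_assign; first arith.
apply: (hoare_while (I := fun j r' m' => [/\ graph_in m', r' xI = j, j <= Z &
  forall a, a < j -> m' (PB + a) = 0])); first by split.
move=> j r' m' fr [gm' rI jZ hz].
have r'Z : r' xZ = Z by rewrite fr.
have r'PB : r' xPB = PB by rewrite fr.
rewrite /= r'Z rI; split=> [|/eqP|].
- by [].
- rewrite eqb0 -leqNgt => Zj; split=> // a aZ; apply: hz; lia.
rewrite eqb0 negbK => ltjZ; split=> //.
apply: hoare_seq; apply: hoare_store; try arith.
apply: hoare_assign; first arith.
rewrite /upd /= r'PB rI addn1; split=> //.
- move=> x y; rewrite -gm'; case: eqP => // h.
  by have := ltn_ord x; have := ltn_ord y; nia.
- move=> a; rewrite ltnS leq_eqVlt eqn_add2l; case: eqP => //= _; exact: hz.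
Qed.

(** * Invariants of the breadth-first search *)

Fixpoint chain m st p : Prop :=
  if p is v :: p' then
    st <> root /\ exists st', [/\ st'.2 = v,
      m (PB + state_index st) = (state_index st').+1 & chain m st' p']
  else st = root.

(** A chain reads only nonzero entries, and the search writes an entry only while it is 0, so chains
    survive later discoveries. *)
Lemma eq_chain m m' st p :
  (forall st', m (PB + state_index st') != 0 ->
     m' (PB + state_index st') = m (PB + state_index st')) ->
  chain m st p -> chain m' st p.
Proof.
move=> hm; elim: p st => //= v p IH st [sr [st' [h1 h2 h3]]]; split=> //.
by exists st'; split=> //; [rewrite hm h2 | exact: IH].
Qed.

(** Nothing is removed from [q], since only the head pointer moves; hence [q] is also the set of
    discovered states. The bound [size p <= i] by queue position later limits the length of the
    output. *)
Definition queued U m (q : seq state) : Prop :=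
  [/\ graph_in m, root \in q /\ uniq q,
      forall i, i < size q -> m (QB + i) = state_index (nth root q i),
      forall st, (m (PB + state_index st) != 0) = (st \in q)
    & forall i, i < size q -> exists p,
        [/\ reach e x0 U (nth root q i) p, chain m (nth root q i) p & size p <= i]].

Lemma uniq_state_size (q : seq state) : uniq q -> size q <= Z.
Proof.
move/card_uniqP <-; apply: leq_trans (max_card _) _.
by rewrite card_prod card_ord -cardsT -powersetT card_powerset cardsT card_ord.
Qed.

Lemma queued_rcons U m (q : seq state) h u :
  let st := nth root q h in let st' := extend st u in
  queued U m q -> h < size q -> allowed e U st u -> st' \notin q ->
  queued U (upd (upd m (PB + state_index st') (state_index st).+1)
              (QB + size q) (state_index st')) (rcons q st').
Proof.
move=> st st' [gm [qr qu] hq hv hp] hh al nq; have [[Z1 Z2 Z3 Z4] Z5 Z6 Z7 [Z8 Z9]] := sizes.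
have lt' := index_lt_Z st'.
have QBne (a : state) : (PB + state_index a == QB + size q) = false.
  by apply/negbTE; have := index_lt_Z a; lia.
have same (a : state) : m (PB + state_index a) != 0 ->
    upd (upd m (PB + state_index st') (state_index st).+1) (QB + size q)
      (state_index st') (PB + state_index a) = m (PB + state_index a).
  rewrite hv /upd QBne eqn_add2l => aq; case: eqP => // /state_index_inj ea.
  by rewrite -ea aq in nq.
split.
- move=> x y; rewrite -gm /upd; have := ltn_ord x; have := ltn_ord y.
  by move=> ? ?; do 2?[case: eqP => [|_]; first nia].
- by rewrite mem_rcons inE qr orbT rcons_uniq nq.
- move=> i; rewrite size_rcons ltnS leq_eqVlt nth_rcons /upd eqn_add2l.
  case: eqP => [->|ne] /=; first by rewrite ltnn.
  move=> lti; rewrite lti -hq // ifF //.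
  by apply/negbTE; have := index_lt_Z st'; have := uniq_state_size qu; lia.
- move=> a; rewrite mem_rcons inE /upd QBne eqn_add2l -hv.
  by case: (eqVneq a st') => [->|ne]; rewrite ?eqxx // (inj_eq (@state_index_inj _)) (negPf ne).
move=> i; rewrite size_rcons ltnS leq_eqVlt nth_rcons => /orP[/eqP->|lti].
  (* The parent sits at position [h], so the new walk has length at most [h.+1 <= size q], the new
     position. *)
  rewrite ltnn eqxx; have [p [p1 p2 p3]] := hp _ hh; exists (st.2 :: p); split=> //=.
  - by apply: reach_extend => //; case: e_simple.
  - split; first by move=> er; rewrite er qr in nq.
    exists st; split=> //; first by rewrite /upd QBne eqxx.
    exact: eq_chain p2.
  - by lia.
rewrite lti; have [p [p1 p2 p3]] := hp _ lti; exists p; split=> //.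
exact: eq_chain p2.
Qed.

Lemma visit_spec U r m (q : seq state) h (u : 'I_N) :
  let st := nth root q h in
  env r -> queued U m q -> h < size q -> r xU = bitmask U -> r xTail = size q ->
  r xQ = state_index st -> r xS = bitmask st.1 -> r xV = st.2 -> r xI = u ->
  hoare w M N visit r m (fun r' m' => exists q',
    [/\ queued U m' q', prefix q q', r' xTail = size q', r' xI = u.+1
      & allowed e U st u -> extend st u \in q']).
Proof.
move=> st [rN rA rZ rPB rQB] hQ hh rU rT rQ rS rV rI.
have [[Z1 Z2 Z3 Z4] Z5 Z6 Z7 [Z8 Z9]] := sizes.
have [gm [qr qu] hq hv hp] := hQ.
have ltu := ltn_ord u; have ltv := ltn_ord st.2; have p2 := pow_lt ltu.
have ltidx := index_lt_Z (extend st u).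
have ltst := index_lt_Z st.
have sq := uniq_state_size qu.
have adr : st.2 * N + u < N * N by nia.
have ltS := bitmask_lt st.1.
apply: hoare_seq; apply: hoare_assign.
  by rewrite /= rI; repeat split; lia.
(* The ascription presents [bit] in the unfolded form left by evaluation. *)
rewrite /= rI rS mul1n (bit_bitmask st.1 u : _ %% 2 = _).
apply: hoare_seq; apply: hoare_assign.
  rewrite /= /upd /= rI rV rN rU mul1n (bit_bitmask U u : _ %% 2 = _) gm.
  by rewrite mulnb; repeat split; lia.
rewrite /= /upd /= rI rV rN rU mul1n (bit_bitmask U u : _ %% 2 = _) gm.
have -> : e st.2 u * (0 < ((u \in st.1 : nat) == 0) + (u \in U)) = allowed e U st u.
  by rewrite /allowed; do 3![case: (_ \in _) || case: (e _ _)].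
have ltX := bitmask_lt (u |: st.1).
have leX : bitmask (u |: st.1) * N <= state_index (extend st u) by exact: leq_addr.
have ltX1 : (u \notin st.1) * 2 ^ u < 2 ^ N by case: (_ \notin _); lia.
apply: hoare_seq; apply: hoare_assign.
  by rewrite /= rI rS rN eqb0 mul1n -bitmaskU1 -/(state_index (extend st u));
    repeat split; lia.
rewrite /= /upd /= rI rS rN eqb0 mul1n -bitmaskU1 -/(state_index (extend st u)).
apply: hoare_seq; apply: hoare_if.
- rewrite /= rPB; repeat split; rewrite ?mulnb; lia.
- rewrite /= rPB mulnb eqb0 negbK => /andP[al nq].
  have {}nq : extend st u \notin q by rewrite -hv negbK.
  have hQ' := queued_rcons hQ hh al nq.
  apply: hoare_seq; apply: hoare_store; rewrite /= ?rPB ?rQ; try by repeat split; lia.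
  (* The extended queue still has no duplicates, so a free cell remains. *)
  have sq' : size q < Z.
    by have [_ [_ uq'] _ _ _] := hQ'; have := uniq_state_size uq'; rewrite size_rcons.
  apply: hoare_seq; apply: hoare_store; rewrite /= ?rQB ?rT; try by repeat split; lia.
  apply: hoare_assign; first by rewrite /= rT; repeat split; lia.
  apply: hoare_assign; first by rewrite /= /upd /= rI; repeat split; lia.
  exists (rcons q (extend st u)); split=> //.
  + by rewrite addn1.
  + exact: prefix_rcons.
  + by rewrite /upd /= rT size_rcons addn1.
  + by rewrite /upd /= rI addn1.
  + by rewrite mem_rcons mem_head.
rewrite /= rPB mulnb => /eqP; rewrite eqb0 => nal.
apply: hoare_skip; apply: hoare_assign; first by rewrite /= rI; repeat split; lia.
exists q; split=> //.
- exact: prefix_refl.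
- by rewrite /upd /= rI addn1.
- by move=> al; move: nal; rewrite al -hv.
Qed.

Definition expanded U (q : seq state) h : Prop :=
  forall i u, i < h -> allowed e U (nth root q i) u -> extend (nth root q i) u \in q.

Lemma prefix_nth (q q' : seq state) i :
  prefix q q' -> i < size q -> nth root q' i = nth root q i.
Proof. by case/prefixP=> l -> lti; rewrite nth_cat lti. Qed.

Lemma mem_prefix (q q' : seq state) st : prefix q q' -> st \in q -> st \in q'.
Proof. by case/prefixP=> l -> qst; rewrite mem_cat qst. Qed.

Lemma expanded_prefix U (q q' : seq state) h :
  prefix q q' -> h <= size q -> expanded U q h -> expanded U q' h.
Proof.
move=> pq hs ex i u lti; rewrite (prefix_nth pq (leq_trans lti hs)) => al.
exact: mem_prefix pq (ex i u lti al).
Qed.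

(** What survives of the search without reference to the queue, whose cells the output will
    overwrite. *)
Definition searched U m : Prop :=
  [/\ graph_in m,
      forall st p, reach e x0 U st p -> m (PB + state_index st) != 0
    & forall st, m (PB + state_index st) != 0 ->
        exists p, [/\ reach e x0 U st p, chain m st p & size p < Z]].

Lemma expanded_searched U m (q : seq state) :
  queued U m q -> expanded U q (size q) -> searched U m.
Proof.
case=> gm [qr qu] hq hv hp ex; split=> // [st p hr|st]; rewrite hv.
  have esym : symmetric e by case: e_simple.
  apply: reach_closed (esym) qr _ hr => st' u /(nthP root)[i lti <-]; exact: ex.
case/(nthP root)=> i lti <-; have [p [p1 p2 p3]] := hp i lti; exists p; split=> //.
exact: leq_ltn_trans p3 (leq_trans lti (uniq_state_size qu)).
Qed.

Lemma expand_spec U r m (q : seq state) h :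
  env r -> queued U m q -> h < size q -> r xU = bitmask U -> r xTail = size q ->
  r xQ = state_index (nth root q h) -> r xS = bitmask (nth root q h).1 ->
  r xV = (nth root q h).2 -> r xI = 0 -> expanded U q h ->
  hoare w M N (while $xI < $xN upto id do visit od)%C r m (fun r' m' =>
    exists q', [/\ queued U m' q', h < size q', r' xTail = size q' & expanded U q' h.+1]).
Proof.
move=> er hQ hh rU rT rQ rS rV rI ex.
apply: (hoare_while (I := fun j r' m' => exists q',
  [/\ [/\ queued U m' q', prefix q q', r' xTail = size q' & r' xI = j], j <= N
    & forall u : 'I_N, u < j -> allowed e U (nth root q h) u ->
        extend (nth root q h) u \in q'])).
  by exists q; split=> //; split=> //; exact: prefix_refl.
move=> j r' m' fr [q' [[hQ' pq rT' rI'] jN hu]].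
have er' : env r' by exact: env_frame fr er.
have rN' : r' xN = N by case: er'.
have hh' : h < size q' by apply: leq_trans hh (size_prefix pq).
have nq := prefix_nth pq hh.
rewrite /= rI' rN'; split=> [|/eqP|].
- by [].
- rewrite eqb0 -leqNgt => Nj; exists q'; split=> // i u; rewrite ltnS leq_eqVlt.
  case/orP=> [/eqP->|lti]; first by rewrite nq; apply: hu; apply: leq_trans Nj.
  exact: expanded_prefix pq (ltnW hh) ex i u lti.
rewrite eqb0 negbK => ltjN; split=> //.
have := @visit_spec U r' m' q' h (Ordinal ltjN) er' hQ' hh'.
rewrite !nq (fr xU) // (fr xQ) // (fr xS) // (fr xV) // => /(_ rU rT' rQ rS rV rI') hv.
apply: hoare_conseq hv _ => r2 m2 _ [q2 [hQ2 pq2 rT2 rI2 al2]].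
exists q2; split=> //; first by split=> //; exact: prefix_trans pq pq2.
move=> u; rewrite ltnS leq_eqVlt => /orP[/eqP ju|ltu].
  by have -> : u = Ordinal ltjN by exact: val_inj.
by move=> /(hu u ltu); apply: mem_prefix pq2.
Qed.

Lemma search_spec U r m :
  env r -> graph_in m -> r xU = bitmask U ->
  hoare w M N search r m (fun r' m' => searched U m').
Proof.
move=> er gm rU; have [[Z1 Z2 Z3 Z4] Z5 Z6 Z7 [Z8 Z9]] := sizes.
apply: hoare_seq; apply: hoare_conseq (clear_spec er gm) _ => {gm} r1 m1 fr1 [gm hz].
have er1 : env r1 by exact: env_frame fr1 er.
have {}rU : r1 xU = bitmask U by rewrite fr1.
case: (er1) => [rN rA rZ rPB rQB].
apply: hoare_seq; apply: hoare_store; rewrite /= ?rPB ?rN; try by repeat split; lia.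
apply: hoare_seq; apply: hoare_store; rewrite /= ?rQB ?rN; try by repeat split; lia.
apply: hoare_seq; apply: hoare_assign; first arith.
apply: hoare_seq; apply: hoare_assign; first arith.
set r2 := upd _ _ _; set m2 := upd _ _ _.
have er2 : env r2 by split; rewrite /r2 /upd /=.
have hQ : queued U m2 [:: root].
  split.
  - move=> x y; rewrite -gm /m2 /upd; have := ltn_ord x; have := ltn_ord y.
    by move=> ? ?; do 2?[case: eqP => [|_]; first nia].
  - by rewrite mem_head.
  - by case=> // _; rewrite /m2 /upd addn0 eqxx /= state_index_root.
  - move=> st; rewrite /m2 /upd inE; have lt := index_lt_Z st.
    rewrite ifF; last by apply/negbTE; lia.
    rewrite eqn_add2l (_ : (_ == N) = (st == root)); last first.
      by rewrite -[RHS](inj_eq (@state_index_inj N)) state_index_root.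
    by case: (st == root); rewrite ?hz.
  - case=> // _; exists [::]; split=> //=; exact: reach_root.
apply: (hoare_while (I := fun h r' m' => exists q,
  [/\ queued U m' q, r' xHead = h, h <= size q, r' xTail = size q & expanded U q h])).
  by exists [:: root].
move=> h r' m' fr [q [hQ' rH hle rT ex]].
have er' : env r' by exact: env_frame fr er2.
have rU' : r' xU = bitmask U by rewrite fr.
have sq : size q <= Z by case: hQ' => _ [_ /uniq_state_size].
case: (er') => rN' rA' rZ' rPB' rQB'.
rewrite /= rH rT; split=> [|/eqP|].
- by [].
- rewrite eqb0 -leqNgt => le; apply: expanded_searched hQ' _.
  by have <- : h = size q by lia.
(* The iteration bound holds because [h < size q <= Z]. *)
rewrite eqb0 negbK => lth; split; first by lia.
have hq : m' (QB + h) = state_index (nth root q h) by case: hQ' => _ _ ->.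
apply: hoare_seq; apply: hoare_assign; first by rewrite /= rQB' rH; repeat split; lia.
rewrite /= rQB' rH hq.
apply: hoare_seq; apply: hoare_assign; first by rewrite /= /upd /= rH; repeat split; lia.
apply: hoare_seq; apply: hoare_assign; first by arith.
apply: hoare_seq; apply: hoare_assign; first by arith.
apply: hoare_seq; apply: hoare_assign; first by arith.
set r3 := upd _ _ _.
have hE : hoare w M N (while $xI < $xN upto id do visit od)%C r3 m' (fun r' m' =>
    exists q', [/\ queued U m' q', h < size q', r' xTail = size q' & expanded U q' h.+1]).
  apply: (expand_spec (q := q)) => //; rewrite /r3 /upd //=.
  - by rewrite rN' state_index_div.
  - by rewrite rN' state_index_mod.
apply: hoare_conseq hE _ => r4 m4 fr4 [q' [hQ4 hs rT4 ex4]].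
by exists q'; split=> //; rewrite fr4 //= /r3 /upd /= rH addn1.
Qed.

(** * Selecting the best set and reading off the walk *)

Definition goal U m g : Prop :=
  exists v p, [/\ g = state_index (setT, v), e v x0, reach e x0 U (setT, v) p,
    chain m (setT, v) p & size p < Z].

Lemma check_spec U r m :
  env r -> searched U m ->
  hoare w M N check r m (fun r' m' => m' = m /\
    if r' xG == 0 then ~ feasible e x0 U else goal U m (r' xG)).
Proof.
move=> er [gm sc ss]; have [[Z1 Z2 Z3 Z4] Z5 Z6 Z7 [Z8 Z9]] := sizes.
apply: hoare_seq; apply: hoare_assign; first arith.
apply: hoare_seq; apply: hoare_assign; first arith.
apply: (hoare_while (I := fun j r' m' => [/\ m' = m, r' xI = j, j <= N
  & if r' xG == 0 then forall v : 'I_N, v < j -> e v x0 -> forall p, ~ reach e x0 U (setT, v) p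
    else goal U m (r' xG)])).
  by split.
move=> j r' m' fr [-> rI jN hG].
have er' : env r' by apply: env_frame fr _ => //; split; rewrite /upd /=; case: er.
case: (er') => rN rA rZ rPB rQB.
rewrite /= rI rN; split=> [|/eqP|].
- by [].
- rewrite eqb0 -leqNgt => Nj; split=> //; case: eqP hG => // _ hG [v [p hp] ev].
  by apply: hG hp => //; apply: leq_trans Nj.
rewrite eqb0 negbK => ltjN; split=> //.
pose v := Ordinal ltjN.
have idx : (2 ^ N - 1) * N + j = state_index (setT, v) by rewrite /state_index bitmaskT.
have ltidx := index_lt_Z (setT, v).
have adj : m (1 + j * N) = e v x0 by rewrite -gm addn0.
have adr : j * N < N * N by nia.
apply: hoare_seq; apply: hoare_assign.
  by rewrite /= rA rN rI; repeat split; lia.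
rewrite /= rA rN rI idx.
apply: hoare_seq; apply: hoare_if.
- rewrite /= /upd /= rI rN rPB adj mulnb; repeat split; lia.
- rewrite /= /upd /= rI rN rPB adj mulnb eqb0 negbK => /andP[ev m0].
  apply: hoare_assign; first arith.
  apply: hoare_assign; first arith.
  rewrite /upd /= rI addn1; split=> //.
  rewrite ifF; last by apply/negbTE; rewrite -idx; nia.
  have [p [p1 p2 p3]] := ss (setT, v) (lt0n_neq0 m0).
  by exists v, p.
rewrite /= /upd /= rI rN rPB adj mulnb => /eqP; rewrite eqb0 => nev.
apply: hoare_skip; apply: hoare_assign; first arith.
rewrite /upd /= rI addn1; split=> //.
case: eqP hG => // _ hG u; rewrite ltnS leq_eqVlt => /orP[/eqP ju|]; last exact: hG.
have -> : u = v by exact: val_inj.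
move=> ev p hp; move: nev; rewrite ev lt0n; case/negP.
exact: sc hp.
Qed.

Lemma find_best_spec r m :
  connected_graph e -> env r -> graph_in m ->
  hoare w M N find_best r m (fun r' m' => [/\ graph_in m'
    & exists B : {set 'I_N}, [/\ r' xBU = bitmask B, feasible e x0 B
        & forall V, feasible e x0 V -> #|B| <= #|V|]]).
Proof.
move=> econ er gm; have [[Z1 Z2 Z3 Z4] Z5 Z6 Z7 [Z8 Z9]] := sizes.
case: (er) => rN rA rZ rPB rQB.
apply: hoare_seq; apply: hoare_assign; first arith.
apply: hoare_seq; apply: hoare_assign; first arith.
apply: (hoare_while (I := fun j r' m' => [/\ graph_in m', r' xU = j, j <= 2 ^ N
  & (r' xBest = N + 1 /\ forall V : {set 'I_N}, bitmask V < j -> ~ feasible e x0 V)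
    \/ exists B : {set 'I_N}, [/\ r' xBU = bitmask B, r' xBest = #|B|, feasible e x0 B
        & forall V : {set 'I_N}, bitmask V < j -> feasible e x0 V -> #|B| <= #|V|]])).
  by split=> //; left; rewrite /upd /= rN.
move=> j r1 m1 fr1 {gm} [gm rU jle hB].
have er1 : env r1 by apply: env_frame fr1 _ => //; split; rewrite /upd /=.
case: (er1) => rN1 rA1 _ _ _.
rewrite /= rU rA1; split=> [|/eqP|].
- by [].
- rewrite eqb0 -leqNgt => lej; split=> //.
  have ltj (V : {set 'I_N}) : bitmask V < j by apply: leq_trans lej; exact: bitmask_lt.
  case: hB => [[_ hV]|[B [b1 b2 b3 b4]]].
    (* Connectivity excludes that no set succeeded. *)
    by case: (hV setT) => //; apply: feasible_setT; rewrite ?card_ord.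
  by exists B; split=> // V; exact: b4.
rewrite eqb0 negbK => ltj; split=> //.
have [U eU] := bitmask_surj ltj; rewrite -eU in rU.
apply: hoare_seq; apply: hoare_conseq (popcount_spec m1 er1 rU) _ => r2 m2 fr2 [-> rC2].
have er2 : env r2 by exact: env_frame fr2 er1.
have rU2 : r2 xU = bitmask U by rewrite fr2.
apply: hoare_seq; apply: hoare_conseq (search_spec er2 gm rU2) _ => r3 m3 fr3 sm.
have er3 : env r3 by exact: env_frame fr3 er2.
apply: hoare_seq; apply: hoare_conseq (check_spec er3 sm) _ => r4 m4 fr4 [-> hG].
have gm3 : graph_in m3 by case: sm.
have rC4 : r4 xCnt = #|U| by rewrite fr4 // fr3.
have rU4 : r4 xU = j by rewrite fr4 // fr3 // rU2.
have cU : #|U| <= N by rewrite -[X in _ <= X]card_ord; exact: max_card.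
have best4 : r4 xBest = r1 xBest by rewrite fr4 // fr3 // fr2.
have bu4 : r4 xBU = r1 xBU by rewrite fr4 // fr3 // fr2.
have last_set V : bitmask V < j.+1 -> V <> U -> bitmask V < j.
  by rewrite ltnS leq_eqVlt -eU => /orP[/eqP/bitmask_inj|].
apply: hoare_seq; apply: hoare_if.
- by rewrite /= mulnb; repeat split; lia.
- rewrite /= mulnb eqb0 negbK => /andP[g0 cb].
  rewrite (negPf (lt0n_neq0 g0)) in hG; have [v [p [p1 p2 p3 p4 p5]]] := hG.
  apply: hoare_seq; apply: hoare_assign; first arith.
  apply: hoare_assign; first arith.
  apply: hoare_assign; first by rewrite /= /upd /= rU4; repeat split; lia.
  rewrite /upd /= rU4 addn1; split=> //; right; exists U; split=> //.
    by exists v => //; exists p.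
  move=> V ltV hV; case: (eqVneq V U) => [->//|/eqP nV].
  case: hB => [[_ nB]|[B [b1 b2 b3 b4]]]; first by case: (nB V) => //; exact: last_set.
  rewrite rC4 best4 b2 in cb; apply: leq_trans (ltnW cb) _.
  by apply: b4 => //; exact: last_set.
rewrite /= mulnb => /eqP; rewrite eqb0 => ncb.
apply: hoare_skip; apply: hoare_assign; first by rewrite /= rU4; repeat split; lia.
rewrite /upd /= rU4 addn1 best4 bu4; split=> //.
rewrite rC4 best4 in ncb.
case: hB => [[b1 nB]|[B [b1 b2 b3 b4]]].
  left; split=> // V ltV hV; case: (eqVneq V U) => [eV|/eqP nV]; last first.
    by apply: (nB V) => //; exact: last_set.
  rewrite b1 in ncb; case: eqP hG => [g0|g0] hG; first by apply: hG; rewrite -eV.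
  (* A success cannot be rejected here, as [#|U| <= N < N + 1]. *)
  by case/negP: ncb; lia.
right; exists B; split=> // V ltV hV; case: (eqVneq V U) => [eV|/eqP nV]; last first.
  by apply: b4 => //; exact: last_set.
rewrite b2 in ncb; case: eqP hG => [g0|g0] hG; first by case: hG; rewrite -eV.
by move: ncb; rewrite lt0n (introN eqP g0) /= -leqNgt eV.
Qed.

Lemma setup_spec r m :
  m 0 = N -> hoare w M N setup r m (fun r' m' => env r' /\ m' = m).
Proof.
move=> m0; have [[Z1 Z2 Z3 Z4] Z5 Z6 Z7 [Z8 Z9]] := sizes.
apply: hoare_seq; apply: hoare_assign; first arith.
rewrite /= m0; apply: hoare_seq; apply: hoare_assign; first arith.
rewrite /= [upd _ _ _ _]/= mul1n; apply: hoare_seq; apply: hoare_assign.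
  by rewrite /= /upd /=; repeat split; lia.
apply: hoare_seq; apply: hoare_assign; first by rewrite /= /upd /=; repeat split; lia.
apply: hoare_assign; first by rewrite /= /upd /=; repeat split; lia.
by rewrite /upd /=.
Qed.

Lemma extract_spec U r m :
  env r -> goal U m (r xG) ->
  hoare w M N extract r m (fun r' m' => exists v p,
    [/\ e v x0, reach e x0 U (setT, v) p, r' xQB + r' xLen <= M, r' xLen = size (v :: p)
      & forall i, i < size (v :: p) -> m' (r' xQB + i) = nth x0 (v :: p) i]).
Proof.
move=> er [v [p [p1 p2 p3 p4 p5]]]; have [[Z1 Z2 Z3 Z4] Z5 Z6 Z7 [Z8 Z9]] := sizes.
case: (er) => rN rA rZ rPB rQB.
(* The output lies above the parent table, so writing it disturbs no chain. *)
have out m' st q (n : nat) x : chain m' st q -> chain (upd m' (QB + n) x) st q.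
  apply: eq_chain => st' _; rewrite /upd ifF //; apply/negbTE.
  by have := index_lt_Z st'; lia.
apply: hoare_seq; apply: hoare_assign; first arith.
apply: hoare_seq; apply: hoare_store; rewrite /= /upd /= ?rQB ?rN; try by repeat split; lia.
apply: hoare_seq; apply: hoare_assign; first arith.
(* The walk splits into the written part [rcons q1 st.2] and the part [q2] still encoded by the
   parents of [st]. *)
apply: (hoare_while (I := fun j r' m' => exists st q1 q2,
  [/\ [/\ v :: p = rcons q1 st.2 ++ q2, size q1 = j & chain m' st q2],
      r' xQ = state_index st, r' xLen = j.+1
    & forall i, i <= j -> m' (QB + i) = nth x0 (rcons q1 st.2) i])).
  exists (setT, v), [::], p; split=> //; first split=> //.
  - by rewrite -[QB]addn0; exact: out.
  - by case=> // _; rewrite addn0 eqxx p1 state_index_mod.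
move=> j r1 m1 fr1 [st [q1 [q2 [[es sz hc] rQ rL hm]]]].
have er1 : env r1 by apply: env_frame fr1 _ => //; split; rewrite /upd /=.
case: (er1) => rN1 rA1 rZ1 rPB1 rQB1.
have jp : j + size q2 = size p.
  by move/(congr1 size): es; rewrite size_cat size_rcons /=; lia.
rewrite /= rQ rN1 eqb0 (_ : (state_index st == N) = (st == root)); last first.
  by rewrite -[RHS](inj_eq (@state_index_inj N)) state_index_root.
split=> [|/eqP|].
- by repeat split; lia.
- rewrite eqb0 negbK => /eqP rt; case: q2 es hc jp => [|u q2] es /= hc jp; last by case: hc.
  exists v, p; split=> //; first by rewrite rQB1 rL; lia.
    by rewrite rL /=; lia.
  by move=> i lti; rewrite es cats0 rQB1; apply: hm; move: lti => /=; lia.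
rewrite eqb0 negbK; case: q2 es hc jp => [|u q2] es /= hc jp rt; first by rewrite hc eqxx in rt.
case: hc => _ [st' [u1 u2 u3]].
split; first by rewrite -/Z; lia.
have lt := index_lt_Z st; have lt' := index_lt_Z st'.
apply: hoare_seq; apply: hoare_assign.
  by rewrite /= rPB1 rQ u2; repeat split; lia.
rewrite /= rPB1 rQ u2.
apply: hoare_seq; apply: hoare_store; rewrite /= /upd /= ?rQB1 ?rL ?rN1; try by repeat split; lia.
apply: hoare_assign; first by rewrite /= rL; repeat split; lia.
rewrite subn1 /= state_index_mod.
exists st', (rcons q1 st.2), q2; split.
- split; first by rewrite es u1 -cat_rcons.
    by rewrite size_rcons sz.
  exact: out.
- by [].
- by rewrite /upd /= rL addn1.
move=> i; rewrite leq_eqVlt eqn_add2l nth_rcons size_rcons sz => /orP[/eqP->|lti].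
  by rewrite !eqxx ltnn.
by rewrite lti hm // ltn_eqF.
Qed.

Lemma main_spec r m :
  connected_graph e -> m 0 = N -> graph_in m ->
  hoare w M N main r m (fun r' m' => exists k s,
    [/\ is_min_UHC_index e k, is_UHC e k s, r' xQB + r' xLen <= M
      & [seq nat_of_ord v | v <- s] = [seq m' (r' xQB + i) | i <- iota 0 (r' xLen)]]).
Proof.
move=> econ m0 gm.
apply: hoare_seq; apply: hoare_conseq (@setup_spec r m m0) _ => r1 m1 _ [er1 ->].
apply: hoare_seq; apply: hoare_conseq (find_best_spec econ er1 gm) _.
move=> r2 m2 fr2 [gm2 [B [rB fB minB]]].
have er2 : env r2 by exact: env_frame fr2 er1.
apply: hoare_seq; apply: hoare_assign => //.
set r3 := upd _ _ _.
have er3 : env r3 by case: er2.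
apply: hoare_seq; apply: hoare_conseq (search_spec (U := B) er3 gm2 rB) _ => r4 m4 fr4 sm.
have er4 : env r4 by exact: env_frame fr4 er3.
apply: hoare_seq; apply: hoare_conseq (check_spec er4 sm) _ => r5 m5 fr5 [-> hG].
have er5 : env r5 by exact: env_frame fr5 er4.
(* [xG = 0] would contradict the feasibility of [B]. *)
case: eqP hG => // _ hG.
apply: hoare_conseq (extract_spec er5 hG) _ => r6 m6 _ [v [p [ev hp le sz hm]]].
have esym : symmetric e by case: e_simple.
have [k1 k2] := best_UHC esym hp ev minB.
exists #|[set x | unbounded (v :: p) x]|, (v :: p); split=> //.
apply: (@eq_from_nth _ 0); first by rewrite !size_map size_iota sz.
move=> i; rewrite size_map => lti.
by rewrite (nth_map x0) // (nth_map 0) ?size_iota ?sz // nth_iota // hm.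
Qed.

End Correctness.

(** * Input encoding, running time and the final program *)

Lemma nth_allpairs (T1 T2 R : Type) (f : T1 -> T2 -> R) s t x0 y0 z0 i j :
  i < size s -> j < size t ->
  nth z0 [seq f x y | x <- s, y <- t] (i * size t + j) = f (nth x0 s i) (nth y0 t j).
Proof.
move=> + ltj; elim: s i => // x s IH [|i] lti; rewrite allpairs_cons nth_cat size_map.
  by rewrite ltj (nth_map y0).
by rewrite ifF ?mulSn -?addnA ?addKn ?IH //; apply/negbTE; lia.
Qed.

Lemma size_encode_graph N (e : rel 'I_N) : size (encode_graph e) = N * N + 1.
Proof. by rewrite /= size_allpairs size_enum_ord addn1. Qed.

Lemma graph_in_encode N (e : rel 'I_N) : graph_in e (nth 0 (encode_graph e)).
Proof.
move=> i j; rewrite -addnA -[in X in nth _ _ (1 + (i * X + j))](size_enum_ord N) /=.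
by rewrite (nth_allpairs _ i j) ?size_enum_ord // !nth_ord_enum.
Qed.

(** The dominant term counts [2 ^ N] sets, [2 ^ N * N] states and [N] successors; the lower
    monomials in [2 ^ N] and [N] are absorbed by it, and the constant generously covers the
    coefficients. The added unit pays for the final [Move]. *)
Lemma ctime_main N : 1 < N -> (ctime N main).+1 <= 50 * 50 * (4 ^ N * N ^ 2).
Proof.
move=> N1; have -> : 4 ^ N * N ^ 2 = 2 ^ N * 2 ^ N * (N * N) by rewrite -expnMn mulnn.
have A1 : 0 < 2 ^ N by rewrite expn_gt0.
rewrite /main /setup /find_best /popcount /search /clear /visit /check /extract.
cbn [ctime csize esize].
move: (2 ^ N) A1 => A A1.
have b1 : A * N * N <= A * A * (N * N) by nia.
have b2 : A * A * N <= A * A * (N * N) by nia.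
have b3 : A * N <= A * N * N by nia.
have b4 : A <= A * N by nia.
have b5 : N <= A * N by nia.
have b6 : A * A <= A * A * N by nia.
have b8 : N * N <= A * N * N by nia.
lia.
Qed.

Theorem mainTheorem5 :
  exists (P : program) (cT cM : nat),
    forall (N : nat) (e : rel 'I_N) (w : nat),
      1 < N ->
      simple_graph e ->
      connected_graph e ->
      N <= w ->
      cM * (2 ^ N * N) <= 2 ^ w ->
      exists (m : nat) (s : seq 'I_N),
        [/\ is_min_UHC_index e m,
            is_UHC e m s
          & computes_within w (cM * (2 ^ N * N)) P (cT * (4 ^ N * N ^ 2))
              (encode_graph e) [seq nat_of_ord v | v <- s]].
Proof.
(* Register 0 already holds the output address [xQB]; the added [Move] places the length in register
   1. *)
exists (code 0 main ++ [:: Move 1 xLen.*2; Halt]), (50 * 50), 8.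
move=> N e w N1 es econ _ Mw.
set P := _ ++ _.
have [hP hE] : code_at P 0 (code 0 main) /\ code_at P (csize main) [:: Move 1 xLen.*2; Halt].
  have hP : code_at P 0 P by [].
  by move: (code_at_cat hP); rewrite size_code.
have [n [rg [r [m [le_n run_n agree _ [k [s [k1 k2 fits out]]]]]]]] :=
  main_spec N1 es Mw (r := fun=> 0) econ erefl (graph_in_encode e) 
    hP (fun x => erefl : (fun=> 0) x.*2 = 0).
rewrite add0n in run_n; exists k, s; split=> //; split.
  by rewrite size_encode_graph; have := ltn_expl N (isT : 1 < 2); nia.
have hE0 := hE 0 isT; have hE1 := hE 1 isT; rewrite addn0 in hE0; rewrite addn1 in hE1.
(* The program and its size are made opaque, so that simplification does not unfold the compiled
   code. *)
clearbody P; move: (csize main) run_n hE0 hE1 => z run_n hE0 hE1.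
exists (n + 1); eexists; split.
- by apply: leq_trans (ctime_main N1); rewrite addn1 ltnS.
- apply: run_trans run_n _.
  by rewrite /= /step /fetch /= hE0.
- exact: hE1.
by rewrite /has_output /= -[0]/(xQB.*2) !agree.
Qed.
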